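(* The cone $\check{\mathcal C}=\{\eta\in\mathfrak X_{\mathbb Q}\mid (\eta,\varpi_i)\ge0 \text{ and } (\eta,\varpi_i-\alpha_i)\ge0\text{ for all } i=1,\dots,r\}$ is generated by the non-simple positive roots, i.e., by $\Delta^+\setminus\Pi$.
   Context: $G$ is a semisimple simply-connected algebraic group of rank $r$ over an algebraically closed field of characteristic zero, with maximal torus $T$, root system $\Delta$, positive roots $\Delta^+$, simple roots $\Pi=\{\alpha_1,\dots,\alpha_r\}$ and corresponding fundamental weights $\varpi_1,\dots,\varpi_r$. $\mathfrak X_{\mathbb Q}=\mathfrak X\otimes\mathbb Q$, where $\mathfrak X$ is the character group of $T$, and $(\ ,\ )$ is a Weyl-group-invariant inner product on it. $\check{\mathcal C}$ is the dual of the cone $\mathcal C\subset\mathfrak X_{\mathbb Q}$ generated by all $\varpi_i,\varpi_i-\alpha_i$, $i=1,\dots,r$. The cone generated by a set consists of all linear combinations of its elements with non-negative rational coefficients (the empty set generates $\{0\}$). *)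

(* Defs.v *)
From mathcomp Require Import all_boot all_order all_algebra.

Set Implicit Arguments.
Unset Strict Implicit.
Unset Printing Implicit Defensive.

Import Order.TTheory GRing.Theory Num.Theory.
Local Open Scope ring_scope.

Definition pairing (R : comNzRingType) (r : nat) (x y : 'rV[R]_r) : R :=
  \sum_i x 0 i * y 0 i.

(* The reflection x |-> x - <x, a'> a. *)
Definition refl (R : comNzRingType) (r : nat) (a a' x : 'rV[R]_r) : 'rV[R]_r :=
  x - pairing x a' *: a.

Definition toQ (r : nat) (x : 'rV[int]_r) : 'rV[rat]_r := map_mx intr x.

(* MathComp has no algebraic groups.  The pair (G, T) enters through its root
   datum: after the choice of a Z-basis of the character group X of T and of the
   dual basis of the cocharacter group, X and its dual are both Z^r, with the
   standard pairing, and X_Q = X (x) Q is Q^r.  By the existence theorem over an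
   algebraically closed field, every reduced root datum arises from a connected
   reductive group, so quantifying over the data below amounts to quantifying
   over (G, T).
   The set of roots is the set of members of the list [roots]; repetitions are
   irrelevant, and only the values of [coroot] on roots matter. *)
Record root_datum (r : nat) := RootDatum {
  roots : seq 'rV[int]_r;
  coroot : 'rV[int]_r -> 'rV[int]_r;
  coroot_inj : {in roots &, injective coroot};
  pairing_coroot : {in roots, forall a, pairing a (coroot a) = 2};
  refl_roots : {in roots &, forall a b, refl a (coroot a) b \in roots};
  refl_coroots : {in roots &, forall a b,
    refl (coroot a) a (coroot b) \in [seq coroot c | c <- roots]}
}.

Section RootDatum.
Variables (r : nat) (D : root_datum r).

Definition reduced : Prop :=
  {in roots D &, forall a b, forall c : rat,
    toQ b = c *: toQ a -> c = 1 \/ c = -1}.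

(* G is semisimple: the roots span X_Q. *)
Definition semisimple : Prop :=
  (<<[seq toQ a | a <- roots D]>>%VS = fullv).

(* G is simply connected: the coroots generate the cocharacter lattice. *)
Definition simply_connected : Prop :=
  forall y : 'rV[int]_r, exists c : 'rV[int]_r -> int,
    y = \sum_(a <- roots D) c a *: coroot D a.

Definition nat_comb (alpha : 'I_r -> 'rV[int]_r) (b : 'rV[int]_r) : Prop :=
  exists c : 'I_r -> nat, b = \sum_i alpha i *+ c i.

Record is_base (alpha : 'I_r -> 'rV[int]_r) : Prop := IsBase {
  base_root : forall i, alpha i \in roots D;
  base_free : row_free (\matrix_(i < r) toQ (alpha i));
  base_comb : {in roots D, forall b, nat_comb alpha b \/ nat_comb alpha (- b)}
}.

(* The positive roots with respect to the base alpha. *)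
Definition positive_root (alpha : 'I_r -> 'rV[int]_r) (b : 'rV[int]_r) : Prop :=
  b \in roots D /\ nat_comb alpha b.

Definition fundamental_weights (alpha varpi : 'I_r -> 'rV[int]_r) : Prop :=
  forall i j, pairing (varpi i) (coroot D (alpha j)) = (i == j)%:R.

(* Every element of the Weyl group acts on X_Q as a composition of reflections
   in a list s of roots. *)
Definition weyl_act (s : seq 'rV[int]_r) (x : 'rV[rat]_r) : 'rV[rat]_r :=
  foldr (fun a y => refl (toQ a) (toQ (coroot D a)) y) x s.

Definition weyl_invariant (f : 'rV[rat]_r -> 'rV[rat]_r -> rat) : Prop :=
  forall s, {subset s <= roots D} ->
    forall x y, f (weyl_act s x) (weyl_act s y) = f x y.

Definition nonsimple_positive (alpha : 'I_r -> 'rV[int]_r) (x : 'rV[rat]_r) :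
    Prop :=
  exists2 b, positive_root alpha b /\ (forall i, b <> alpha i) & x = toQ b.

End RootDatum.

Definition cone (V : lmodType rat) (S : V -> Prop) (x : V) : Prop :=
  exists (n : nat) (v : 'I_n -> V) (c : 'I_n -> rat),
    [/\ forall i, S (v i), forall i, 0 <= c i & x = \sum_i c i *: v i].

Definition dual_cone (V : lmodType rat) (f : V -> V -> rat) (C : V -> Prop)
    (eta : V) : Prop :=
  forall x, C x -> 0 <= f eta x.

Definition cone_C (r : nat) (alpha varpi : 'I_r -> 'rV[int]_r) :
    'rV[rat]_r -> Prop :=
  cone (fun x => exists i, x = toQ (varpi i) \/ x = toQ (varpi i - alpha i)).

(* Main.v *)
Require Import Defs.
From mathcomp Require Import all_boot all_order all_algebra ring lra.

Set Implicit Arguments.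
Unset Strict Implicit.
Unset Printing Implicit Defensive.

Import Order.TTheory GRing.Theory Num.Theory.
Local Open Scope ring_scope.

(** Write [eta] as the sum of the [k i *: alpha i].  Invariance of the form
    gives [f eta (varpi i) = d i * k i] and
    [f eta (alpha i) = d i * <eta, alpha_i^vee>] with
    [d i = (alpha i, alpha i) / 2 > 0], so the dual cone is cut out by
    [k i >= 0] and [k i >= <eta, alpha_i^vee>].  With
    [N i j = - <alpha_j, alpha_i^vee>] for [i != j] and [N i i = 0], the second
    family of inequalities reads [k i <= \sum_j N i j * k j]
    ([dual_cone_coord], [coroot_slackE]).

    A positive root [b] other than [alpha i] satisfies the [i]-th inequality,
    because its reflection [b - <b, alpha_i^vee> alpha_i] is again a positive
    root and so has a nonnegative [i]-th coordinate ([nonsimple_slack_ge0]).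
    Hence the non-simple positive roots lie in the dual cone.

    Conversely, it is enough to find, in the smallest face containing a given
    nonzero [eta] of the dual cone, a non-simple positive root [b]: subtracting
    the largest multiple of [b] that stays in the cone makes one more inequality
    tight, and one concludes by induction ([cone_of_face_generators]).  Such a
    root is found among the stars
    [alpha i + \sum_(t in S) N t i *: alpha t],
    where [S] is a nonempty set of neighbours of [i] in the Dynkin diagram, no
    two of them adjacent.  A star is a root, since it is the image of [alpha i]
    under the commuting reflections indexed by [S] ([star_root_in_roots]).  That
    each face contains a star ([face_star]) is a statement about the matrix [N]
    alone.  Call an index tight when its coordinate is nonzero and its
    inequality is an equality.  If two adjacent indices are tight, the two
    equalities force the edge joining them to be simple and isolated in the
    support of [eta], and the sum of the two simple roots is in the face.  If
    not, a tight [t] has a neighbour [i] in the support that is not tight, and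
    the star with centre [i] and with all the tight neighbours of [i] as [S]
    satisfies every equality that [eta] does.  If no index is tight, any edge of
    the support will do. *)

(** * Cones cut out by finitely many inequalities *)

Lemma cone0 (V : lmodType rat) (S : V -> Prop) : cone S 0.
Proof.
by exists 0%N, (fun=> 0), (fun=> 0); split=> [[]|[]|] //; rewrite big_ord0.
Qed.

Lemma cone_scaleD (V : lmodType rat) (S : V -> Prop) (a : rat) b x :
  0 <= a -> S b -> cone S x -> cone S (a *: b + x).
Proof.
move=> a_ge0 Sb [n [v [c [Sv c_ge0 ->]]]].
exists n.+1, (fun i => oapp v b (unlift ord0 i)),
  (fun i => oapp c a (unlift ord0 i)).
split=> [i|i|] /=; [by case: unliftP => /= | by case: unliftP => /= |].
rewrite big_ord_recl unlift_none; congr (_ + _).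
by apply: eq_bigr => i _; rewrite liftK.
Qed.

Lemma cone_gen (V : lmodType rat) (S : V -> Prop) b : S b -> cone S b.
Proof.
by move=> Sb; have := cone_scaleD ler01 Sb (cone0 S); rewrite scale1r addr0.
Qed.

Section Functionals.
Variables (V : lmodType rat) (J : finType) (L : J -> V -> rat) (S : V -> Prop).
Hypothesis L_linear :
  forall m a v w, L m (a *: v + w) = a * L m v + L m w.

Let L0 m : L m 0 = 0.
Proof. by have := L_linear m 1 0 0; rewrite scaler0 addr0; lra. Qed.

Lemma cone_functional_ge0 m :
  (forall b, S b -> 0 <= L m b) -> forall x, cone S x -> 0 <= L m x.
Proof.
move=> L_ge0 x [n [v [c [Sv c_ge0 ->]]]].
elim/big_rec: _ => [|i y _ y_ge0]; first by rewrite L0.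
by rewrite L_linear addr_ge0 // mulr_ge0 // L_ge0.
Qed.

(** A descent through faces: [w = v - e *: b], with [e] the smallest ratio
    [L m v / L m b], lies in a proper face of the one spanned by [v], so the
    number of functionals that do not vanish at the point strictly decreases. *)
Lemma cone_of_face_generators :
  (forall v, (forall m, 0 <= L m v) -> v <> 0 ->
     exists b, [/\ S b, forall m, 0 <= L m b,
       forall m, L m v = 0 -> L m b = 0 & exists m, L m b <> 0]) ->
  forall v, (forall m, 0 <= L m v) -> cone S v.
Proof.
move=> face v; have [n] := ubnP #|[pred m | L m v != 0]|.
elim: n v => // n IHn v; rewrite ltnS => le_n v_ge0.
have [->|/eqP v_neq0] := eqVneq v 0; first exact: cone0.
have [b [Sb b_ge0 v0b0 [m1 /eqP m1b]]] := face v v_ge0 v_neq0.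
have m1b_gt0 : 0 < L m1 b by rewrite lt0r m1b b_ge0.
(* [m0] is the first inequality to become tight along [v - e *: b]. *)
pose m0 := [arg min_(m < m1 | 0 < L m b) (L m v / L m b)]%O.
have [m0b m0_min] : 0 < L m0 b /\
    forall m, 0 < L m b -> L m0 v / L m0 b <= L m v / L m b.
  by rewrite /m0; case: arg_minP => // i.
pose e := L m0 v / L m0 b.
have e_ge0 : 0 <= e by rewrite divr_ge0 // ltW.
have Lw m : L m (- e *: b + v) = L m v - e * L m b.
  by rewrite L_linear mulNr addrC.
suff: cone S (- e *: b + v).
  by move=> /(cone_scaleD e_ge0 Sb); rewrite scaleNr addrA subrr add0r.
apply: IHn => [|m]; last first.
  rewrite Lw subr_ge0.
  have [mb|] := ltrP 0 (L m b); first by rewrite -ler_pdivlMr // m0_min.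
  by move=> mb; rewrite (le_trans _ (v_ge0 m)) // mulr_ge0_le0.
apply: leq_trans le_n; apply/proper_card/properP; split.
  apply/subsetP=> m; rewrite !inE Lw; apply: contra_neq => mv.
  by rewrite mv (v0b0 _ mv) mulr0 subr0.
exists m0; rewrite !inE ?Lw.
  by apply: contraTneq m0b => /v0b0->; rewrite ltxx.
by rewrite negbK /e divfK ?subrr // gt_eqF.
Qed.
End Functionals.

(** * Stars in the faces of a Cartan cone *)

Section Star.
Variables (I : finType) (N : I -> I -> nat).
Hypothesis N_diag : forall i, N i i = 0%N.
Hypothesis N_sym0 : forall i j, N i j = 0%N -> N j i = 0%N.

(** For [N] the negated off-diagonal part of a Cartan matrix and [x] the
    coordinates of [eta] on the simple roots, this is
    [x i - <eta, alpha_i^vee>]; the diagonal entry 2 turns [+ x i] into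
    [- x i]. *)
Definition slack (x : I -> rat) i : rat := \sum_j (N i j)%:R * x j - x i.

(** The coordinates of the image of [alpha i] under the reflections indexed by
    [S], when these reflections commute. *)
Definition star i (S : {set I}) l : rat :=
  ((l == i) + (l \in S) * N l i)%:R.

Lemma slack_star i S l :
  slack (star i S) l =
  (N l i)%:R + (\sum_(j in S) N l j * N j i)%:R - star i S l.
Proof.
rewrite /slack /star; congr (_ - _).
under [LHS]eq_bigr do rewrite natrD mulrDr.
rewrite big_split /= (bigD1 i) //= eqxx mulr1 big1 ?addr0; last first.
  by move=> j /negPf ->; rewrite mulr0.
congr (_ + _); rewrite natr_sum [RHS]big_mkcond /=.
by apply: eq_bigr => j _; case: (j \in S); rewrite ?mul1n ?mul0n ?mulr0 ?natrM.
Qed.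

Record admissible_star i (S : {set I}) : Prop := AdmissibleStar {
  star_nonempty : exists t, t \in S;
  star_adjacent : forall t, t \in S -> N t i != 0%N;
  star_independent : forall t u, t \in S -> u \in S -> N t u = 0%N
}.

Lemma admissible_edge i j : N i j <> 0%N -> admissible_star i [set j].
Proof.
move=> Nij; split=> [|t|t u]; first by exists j; rewrite inE.
  by rewrite inE => /eqP ->; apply/eqP => /N_sym0.
by rewrite !inE => /eqP -> /eqP ->.
Qed.

Section Face.
Variable x : I -> rat.
Hypothesis x_ge0 : forall i, 0 <= x i.
Hypothesis slack_ge0 : forall i, 0 <= slack x i.

Let term_ge0 i j : 0 <= (N i j)%:R * x j.
Proof. by rewrite mulr_ge0. Qed.

Let term_eq0 i j : (N i j)%:R * x j = 0 -> x j <> 0 -> N i j = 0%N.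
Proof.
by move=> /eqP; rewrite mulf_eq0 pnatr_eq0 => /orP[/eqP //|/eqP].
Qed.

Lemma has_neighbour i : x i <> 0 -> exists2 j, N i j <> 0%N & x j <> 0.
Proof.
move=> xi; have [j|none] := pickP (fun j => (N i j != 0%N) && (x j != 0)).
  by case/andP=> /eqP Nij /eqP xj; exists j.
have := slack_ge0 i; rewrite /slack big1 ?sub0r; last first.
  move=> j _; apply/eqP; rewrite mulf_eq0 pnatr_eq0.
  by have := none j; case: eqP => //= _; case: eqP.
by have := x_ge0 i; lra.
Qed.

(** Outside the support of [x] nothing has to be checked: an equality there says
    that the index has no neighbour in the support of [x], hence none in the
    support of the star. *)
Lemma star_in_face i (S : {set I}) :
  x i <> 0 -> (forall t, t \in S -> x t <> 0) ->
  (forall l, x l <> 0 -> slack x l = 0 -> slack (star i S) l = 0) ->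
  (forall l, x l = 0 -> star i S l = 0) /\
  (forall l, slack x l = 0 -> slack (star i S) l = 0).
Proof.
move=> xi xS tight.
have supp l : x l = 0 -> star i S l = 0.
  move=> xl; rewrite /star; have [li|_] := eqVneq l i.
    by rewrite li in xl.
  by case: (boolP (l \in S)) => // /xS.
split=> // l sl0; have [xl0|/eqP xl] := eqVneq (x l) 0; last exact: tight.
rewrite /slack supp // subr0; apply: big1 => j _.
have [/supp ->|/eqP xj] := eqVneq (x j) 0; first by rewrite mulr0.
suff -> : N l j = 0%N by rewrite mul0r.
apply: term_eq0 xj; move: sl0; rewrite /slack xl0 subr0 => /psumr_eq0P -> //.
Qed.

(** The two equalities give [x i >= N i j * x j >= x j] and
    [x j >= N j i * x i >= x i], so all these are equal and every other term of
    the two sums vanishes. *)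
Lemma tight_edge i j : slack x i = 0 -> slack x j = 0 -> x i <> 0 ->
  N i j <> 0%N ->
  [/\ N i j = 1%N, N j i = 1%N,
      forall l, l != j -> x l <> 0 -> N i l = 0%N &
      forall l, l != i -> x l <> 0 -> N j l = 0%N].
Proof.
rewrite /slack => + + xi Nij.
have Nji : N j i <> 0%N by move/N_sym0.
rewrite (bigD1 j) //= [X in _ -> X - _ = 0 -> _](bigD1 i) //=.
set A := \sum_(_ | _) _; set B := \sum_(_ | _) _ => eq_i eq_j.
have A_ge0 : 0 <= A by apply: sumr_ge0.
have B_ge0 : 0 <= B by apply: sumr_ge0.
have xi_gt0 : 0 < x i by rewrite lt0r x_ge0 andbT; apply/eqP.
have Nij1 : 1 <= (N i j)%:R :> rat by rewrite ler1n lt0n; apply/eqP.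
have Nji1 : 1 <= (N j i)%:R :> rat by rewrite ler1n lt0n; apply/eqP.
have xj_ge0 := x_ge0 j.
have le1 : x j <= (N i j)%:R * x j by rewrite ler_peMl.
have le2 : x i <= (N j i)%:R * x i by rewrite ler_peMl // ltW.
have xij : x i = x j by lra.
have A0 : A = 0 by lra.
have B0 : B = 0 by lra.
have n1 : (N i j)%:R = 1 :> rat by apply: (mulIf (x := x j)); lra.
have n2 : (N j i)%:R = 1 :> rat by apply: (mulIf (x := x i)); lra.
split; [by apply/eqP; rewrite -(eqr_nat rat) n1
       |by apply/eqP; rewrite -(eqr_nat rat) n2|move=> l lj xl|move=> l li xl].
- by apply: term_eq0 xl; move/psumr_eq0P: A0 => -> //.
- by apply: term_eq0 xl; move/psumr_eq0P: B0 => -> //.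
Qed.

(** The three cases are: two adjacent tight indices; tight indices, no two of
    them adjacent; no tight index. *)
Lemma face_star : (exists i, x i <> 0) ->
  exists i S, [/\ admissible_star i S, forall l, x l = 0 -> star i S l = 0 &
    forall l, slack x l = 0 -> slack (star i S) l = 0].
Proof.
move=> [i0 xi0].
pose T := [set t | (x t != 0) && (slack x t == 0)].
have inT t : reflect (x t <> 0 /\ slack x t = 0) (t \in T).
  by rewrite inE; apply: (iffP andP) => -[/eqP ? /eqP ?].
have [[i j]|T_indep] :=
    pickP (fun p : I * I => [&& p.1 \in T, p.2 \in T & N p.1 p.2 != 0%N]).
  case/and3P=> /inT[xi si] /inT[xj sj] /eqP /= Nij; exists i, [set j].
  have [n1 n2 Ni Nj] := tight_edge si sj xi Nij.
  suff [supp tight] : (forall l, x l = 0 -> star i [set j] l = 0) /\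
      (forall l, slack x l = 0 -> slack (star i [set j]) l = 0).
    by split=> //; apply: admissible_edge.
  apply: star_in_face => // [t|l xl sl]; first by rewrite inE => /eqP ->.
  rewrite slack_star big_set1 n2 /star inE.
  have [->|li] := eqVneq l i.
    by rewrite N_diag n1; case: eqP => // ij; move: n1; rewrite -ij N_diag.
  have [->|lj] := eqVneq l j; first by rewrite N_diag n2.
  by rewrite (N_sym0 (Ni l lj xl)) (N_sym0 (Nj l li xl)).
have {}T_indep t u : t \in T -> u \in T -> N t u = 0%N.
  by move=> tT uT; have := T_indep (t, u); rewrite /= tT uT => /negbFE/eqP.
have [t tT|T0] := pickP (fun t => t \in T).
  have /inT[xt st] := tT.
  have [i Nti xi] := has_neighbour xt.
  have iT : i \notin T by apply/negP => iT; apply: Nti; apply: T_indep.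
  pose S := [set u in T | N u i != 0%N].
  have inS u : (u \in S) = (u \in T) && (N u i != 0%N) by rewrite [LHS]inE.
  suff [supp tight] : (forall l, x l = 0 -> star i S l = 0) /\
      (forall l, slack x l = 0 -> slack (star i S) l = 0).
    exists i, S; split=> //; split=> [|u|u w].
    - by exists t; rewrite inS tT; apply/eqP.
    - by rewrite inS => /andP[].
    - by rewrite !inS => /andP[uT _] /andP[wT _]; apply: T_indep.
  apply: star_in_face => // [u|l xl sl]; first by rewrite inS => /andP[/inT[]].
  have lT : l \in T by apply/inT.
  rewrite slack_star big1; last first.
    by move=> j; rewrite inS => /andP[jT _]; rewrite T_indep.
  rewrite /star inS lT; have [li|_] := eqVneq l i.
    by rewrite -li lT in iT.
  by case: eqP => [->|_]; rewrite ?mul1n addr0 subrr.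
have [j Nij xj] := has_neighbour xi0.
suff [supp tight] : (forall l, x l = 0 -> star i0 [set j] l = 0) /\
    (forall l, slack x l = 0 -> slack (star i0 [set j]) l = 0).
  by exists i0, [set j]; split=> //; apply: admissible_edge.
apply: star_in_face => // [t|l xl sl]; first by rewrite inE => /eqP ->.
by have /inT := conj xl sl; rewrite [_ \in _](T0 l).
Qed.
End Face.
End Star.

(** * Pairings and coordinates on the simple roots *)

Lemma pairing_linearl (R : comNzRingType) r a (x y z : 'rV[R]_r) :
  pairing (a *: x + y) z = a * pairing x z + pairing y z.
Proof.
rewrite /pairing mulr_sumr -big_split /=.
by apply: eq_bigr => i _; rewrite !mxE mulrDl mulrA.
Qed.

Lemma pairing0l (R : comNzRingType) r (z : 'rV[R]_r) : pairing 0 z = 0.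
Proof. by rewrite /pairing big1 // => i _; rewrite mxE mul0r. Qed.

Lemma pairing_suml (R : comNzRingType) r (I : Type) (s : seq I) (P : pred I)
    (c : I -> R) (x : I -> 'rV[R]_r) z :
  pairing (\sum_(i <- s | P i) c i *: x i) z =
  \sum_(i <- s | P i) c i * pairing (x i) z.
Proof.
elim/big_rec2: _ => [|i u v _ <-]; first exact: pairing0l.
by rewrite pairing_linearl.
Qed.

Lemma pairing_toQ r (x y : 'rV[int]_r) :
  pairing (toQ x) (toQ y) = (pairing x y)%:~R.
Proof.
rewrite /pairing rmorph_sum; apply: eq_bigr => i _.
by rewrite !mxE rmorphM.
Qed.

Lemma toQB r (x y : 'rV[int]_r) : toQ (x - y) = toQ x - toQ y.
Proof. exact: map_mxB. Qed.

Lemma toQ_sum r (I : Type) (s : seq I) (c : I -> nat) (x : I -> 'rV[int]_r) :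
  toQ (\sum_(i <- s) x i *+ c i) = \sum_(i <- s) (c i)%:R *: toQ (x i).
Proof.
rewrite /toQ raddf_sum; apply: eq_bigr => i _.
by rewrite raddfMn scaler_nat.
Qed.

Lemma toQ_refl r (a a' x : 'rV[int]_r) :
  toQ (refl a a' x) = refl (toQ a) (toQ a') (toQ x).
Proof. by rewrite /refl toQB pairing_toQ /toQ map_mxZ. Qed.

Section Coordinates.
Variables (r : nat) (alpha : 'I_r -> 'rV[int]_r).

Definition simple_coord (v : 'rV[rat]_r) (i : 'I_r) : rat :=
  (v *m invmx (\matrix_(i < r) toQ (alpha i))) 0 i.

Lemma simple_coord_linear i a v w :
  simple_coord (a *: v + w) i = a * simple_coord v i + simple_coord w i.
Proof. by rewrite /simple_coord mulmxDl -scalemxAl !mxE. Qed.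

Hypothesis alpha_free : row_free (\matrix_(i < r) toQ (alpha i)).

Let sum_mulmx (c : 'I_r -> rat) :
  \sum_i c i *: toQ (alpha i) = (\row_i c i) *m \matrix_(i < r) toQ (alpha i).
Proof.
by rewrite mulmx_sum_row; apply: eq_bigr => i _; rewrite rowK mxE.
Qed.

Lemma simple_coord_sum (c : 'I_r -> rat) j :
  simple_coord (\sum_i c i *: toQ (alpha i)) j = c j.
Proof.
by rewrite /simple_coord sum_mulmx mulmxK -?row_free_unit // mxE.
Qed.

Lemma simple_coordK v : \sum_i simple_coord v i *: toQ (alpha i) = v.
Proof.
have A_unit := alpha_free; rewrite row_free_unit in A_unit.
rewrite sum_mulmx -[RHS](mulmxKV A_unit).
by congr (_ *m _); apply/rowP => i; rewrite mxE.
Qed.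

Lemma simple_coord_simple i j : simple_coord (toQ (alpha i)) j = (i == j)%:R.
Proof.
rewrite -(simple_coord_sum (fun j => (i == j)%:R)).
rewrite (bigD1 i) //= eqxx scale1r big1 ?addr0 // => l.
by rewrite eq_sym => /negPf ->; rewrite scale0r.
Qed.
End Coordinates.

(** * Non-simple positive roots *)

Section Roots.
Variables (r : nat) (D : root_datum r) (alpha : 'I_r -> 'rV[int]_r).
Hypotheses (D_reduced : reduced D) (alpha_base : is_base D alpha).

Let alpha_free := base_free alpha_base.
Let alpha_root := base_root alpha_base.
Local Notation coord := (simple_coord alpha).
Local Notation cosimple i := (toQ (coroot D (alpha i))).

Lemma nat_comb_coord b : nat_comb alpha b ->
  exists c : 'I_r -> nat, forall i, coord (toQ b) i = (c i)%:R.
Proof.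
by move=> [c ->]; exists c => i; rewrite toQ_sum simple_coord_sum.
Qed.

(** The coordinates of a root all have the same sign, so a single positive one
    decides that the root is positive. *)
Lemma nat_comb_of_coord_gt0 b i :
  b \in Defs.roots D -> 0 < coord (toQ b) i -> nat_comb alpha b.
Proof.
move=> /(base_comb alpha_base) [//|/nat_comb_coord [c cE]] b_gt0.
have := cE i; rewrite /toQ map_mxN /simple_coord mulNmx mxE -/(coord _ i).
by have : 0 <= (c i)%:R :> rat by []; lra.
Qed.

Definition coroot_slack (v : 'rV[rat]_r) i : rat :=
  coord v i - pairing v (cosimple i).

Lemma coroot_slack_linear i a v w :
  coroot_slack (a *: v + w) i = a * coroot_slack v i + coroot_slack w i.
Proof. by rewrite /coroot_slack simple_coord_linear pairing_linearl; ring. Qed.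

Lemma coord_refl b i l :
  coord (toQ (refl (alpha i) (coroot D (alpha i)) b)) l =
  coord (toQ b) l - pairing (toQ b) (cosimple i) * (i == l)%:R.
Proof.
rewrite toQ_refl /refl addrC -scaleNr simple_coord_linear.
by rewrite simple_coord_simple // mulNr addrC.
Qed.

(** The reflection in [alpha i] changes only the [i]-th coordinate, so it keeps
    the positive [l]-th one and the image of [b] is still positive; its [i]-th
    coordinate is the slack. *)
Lemma root_slack_ge0 b i l : b \in Defs.roots D -> l != i ->
  0 < coord (toQ b) l -> 0 <= coroot_slack (toQ b) i.
Proof.
move=> b_root li b_gt0.
have s_root := refl_roots (alpha_root i) b_root.
have := coord_refl b i l; rewrite eq_sym (negPf li) mulr0 subr0 => sl.
have [|c cE] := nat_comb_coord (nat_comb_of_coord_gt0 s_root (i := l) _).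
  by rewrite sl.
by have := coord_refl b i i; rewrite eqxx mulr1 cE /coroot_slack => <-.
Qed.

(** Here the root system has to be reduced: a positive root supported at [i]
    alone is a multiple of [alpha i], hence [alpha i] itself. *)
Lemma nonsimple_slack_ge0 b i : positive_root D alpha b ->
  (forall j, b <> alpha j) -> 0 <= coroot_slack (toQ b) i.
Proof.
move=> [b_root b_comb] b_nonsimple.
have [c cE] := nat_comb_coord b_comb.
have [l /andP[li cl]|c0] := pickP (fun l => (l != i) && (c l != 0%N)).
  by apply: root_slack_ge0 b_root li _; rewrite cE ltr0n lt0n.
have bE : toQ b = (c i)%:R *: toQ (alpha i).
  rewrite -(simple_coordK alpha_free (toQ b)) (bigD1 i) //= cE big1 ?addr0 //.
  move=> l li; have := c0 l; rewrite cE li => /eqP ->.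
  by rewrite scale0r.
have [c1|] := D_reduced (alpha_root i) b_root bE; last first.
  by have : 0 <= (c i)%:R :> rat by []; lra.
case: (b_nonsimple i); move: bE; rewrite c1 scale1r.
by move/rowP => bE; apply/rowP => l; have := bE l; rewrite !mxE => /intr_inj.
Qed.

(** Off-diagonal Cartan integers are nonpositive, so the absolute value negates
    them. *)
Definition cartan (i j : 'I_r) : nat :=
  if i == j then 0%N else `|pairing (alpha j) (coroot D (alpha i))|%N.

Lemma cartan_diag i : cartan i i = 0%N.
Proof. by rewrite /cartan eqxx. Qed.

Lemma pairing_simple i j :
  pairing (alpha j) (coroot D (alpha i)) = 2 * (j == i)%:R - (cartan i j)%:R.
Proof.
rewrite /cartan eq_sym; have [->|ji] := eqVneq j i.
  by rewrite (pairing_coroot (alpha_root i)) mulr1 subr0.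
(* The slack of the root [alpha j] at [i != j] is minus the Cartan integer. *)
have := @root_slack_ge0 (alpha j) i j (alpha_root j) ji.
rewrite /coroot_slack !simple_coord_simple // eqxx (negPf ji) pairing_toQ.
rewrite sub0r oppr_ge0 lerz0 => /(_ ltr01) le0.
by rewrite mulr0 sub0r natz abszE ler0_norm // opprK.
Qed.

Lemma coroot_slackE v i : coroot_slack v i = slack cartan (coord v) i.
Proof.
rewrite /coroot_slack /slack -{2}(simple_coordK alpha_free v) pairing_suml.
under eq_bigr => j _.
  rewrite pairing_toQ pairing_simple rmorphB /= rmorphM /= !rmorph_nat mulrBr.
  over.
rewrite sumrB (bigD1 i) //= eqxx big1 ?addr0; last first.
  by move=> j /negPf ->; rewrite !mulr0.
under [in RHS]eq_bigr do rewrite mulrC.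
by rewrite mulr1n mulr1; lra.
Qed.

Definition star_root i (s : seq 'I_r) : 'rV[int]_r :=
  alpha i + \sum_(t <- s) alpha t *+ cartan t i.

(** Each reflection in [alpha t], for [t] in [s], adds [cartan t i] times
    [alpha t]: the terms of [s] already present are orthogonal to [alpha t]. *)
Lemma star_root_in_roots i s : uniq s -> {in s, forall t, cartan t i != 0%N} ->
  {in s &, forall t u, cartan t u = 0%N} -> star_root i s \in Defs.roots D.
Proof.
elim: s => [|t s IHs] /=.
  by rewrite /star_root big_nil addr0.
move=> /andP[ts s_uniq] adj indep.
have s_root : star_root i s \in Defs.roots D.
  apply: IHs => // [u us|u w us ws].
    by apply: adj; rewrite inE us orbT.
  by apply: indep; rewrite inE ?us ?ws orbT.
have ti : t != i.
  by apply: contraTneq (adj t (mem_head _ _)) => ->; rewrite cartan_diag.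
suff -> : star_root i (t :: s) =
    refl (alpha t) (coroot D (alpha t)) (star_root i s).
  exact: refl_roots.
suff pE : pairing (star_root i s) (coroot D (alpha t)) = - (cartan t i)%:R.
  rewrite /refl pE scaleNr opprK scaler_nat /star_root big_cons.
  by rewrite addrCA addrC.
rewrite /star_root -[alpha i]scale1r pairing_linearl mul1r pairing_simple.
rewrite eq_sym (negPf ti) mulr0 sub0r.
under eq_bigr do rewrite -scaler_nat.
rewrite pairing_suml big_seq big1 ?addr0 // => u us.
have tu : cartan t u = 0%N by apply: indep; rewrite inE ?us ?eqxx ?orbT.
rewrite pairing_simple tu.
have -> : (u == t) = false by apply: contraNF ts => /eqP <-.
by rewrite !mulr0n !mulr0.
Qed.

Lemma coord_star_root i (S : {set 'I_r}) l :
  coord (toQ (star_root i (enum S))) l = star cartan i S l.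
Proof.
rewrite /star_root /toQ map_mxD -/(toQ _) -/(toQ _) -[toQ (alpha i)]scale1r.
rewrite simple_coord_linear simple_coord_simple // mul1r /star natrD eq_sym.
congr (_ + _); pose c t := ((t \in S) * cartan t i)%N.
rewrite -[RHS](simple_coord_sum alpha_free (fun t => (c t)%:R)) toQ_sum.
congr (simple_coord _ _ _); rewrite big_enum [LHS]big_mkcond /=.
by apply: eq_bigr => t _; rewrite /c; case: (t \in S);
  rewrite ?mul1n ?mul0n ?scale0r.
Qed.

Lemma star_nonsimple_positive i (S : {set 'I_r}) :
  admissible_star cartan i S ->
  nonsimple_positive D alpha (toQ (star_root i (enum S))).
Proof.
move=> [[t tS] adj indep].
have ti : t != i.
  by apply: contraTneq (adj t tS) => ->; rewrite cartan_diag.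
have s_root : star_root i (enum S) \in Defs.roots D.
  apply: star_root_in_roots => [|u|u w]; rewrite ?enum_uniq ?mem_enum //.
    exact: adj.
  exact: indep.
have coord_i : 0 < coord (toQ (star_root i (enum S))) i.
  by rewrite coord_star_root /star eqxx ltr0n.
have coord_t : 0 < coord (toQ (star_root i (enum S))) t.
  by rewrite coord_star_root /star (negPf ti) tS mul1n ltr0n lt0n adj.
exists (star_root i (enum S)) => //; split=> [|j jE].
  by split; last exact: nat_comb_of_coord_gt0 coord_i.
move: coord_i coord_t; rewrite jE !simple_coord_simple //.
by case: eqP => // ->; rewrite eq_sym (negPf ti).
Qed.

(** * The dual cone *)

Section Form.
Variable f : {dot 'rV[rat]_r for (@idfun rat)}.
Hypothesis f_inv : weyl_invariant D f.

Let fC x y : f x y = f y x.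
Proof. by rewrite hermC expr0 mul1r. Qed.

Definition half_norm i : rat := f (toQ (alpha i)) (toQ (alpha i)) / 2.

Lemma half_norm_gt0 i : 0 < half_norm i.
Proof.
rewrite divr_gt0 // neq0_dnorm_gt0 //; apply/eqP => ai0.
have := simple_coord_simple alpha_free i i.
by rewrite ai0 /simple_coord mul0mx mxE eqxx.
Qed.

(** Apply the reflection in [alpha i] to both arguments: the form is unchanged,
    and [alpha i] becomes its opposite. *)
Lemma form_simple v i :
  f v (toQ (alpha i)) = pairing v (cosimple i) * half_norm i.
Proof.
have sub : {subset [:: alpha i] <= Defs.roots D}.
  by move=> b; rewrite inE => /eqP ->; apply: alpha_root.
have := f_inv sub v (toQ (alpha i)); rewrite /weyl_act /= /refl.
rewrite pairing_toQ (pairing_coroot (alpha_root i)) /half_norm.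
have -> : (2 : int)%:~R = 2 :> rat by [].
rewrite linearBr !linearBl /= !linearZl_LR /= !linearZr_LR /=; lra.
Qed.

(** For [i != j], both vanish exactly when [alpha i] and [alpha j] are
    orthogonal. *)
Lemma cartan_sym0 i j : cartan i j = 0%N -> cartan j i = 0%N.
Proof.
have [->//|ij] := eqVneq i j; move=> cij.
have := form_simple (toQ (alpha j)) i; rewrite fC form_simple.
rewrite !pairing_toQ !pairing_simple cij (eq_sym j i) (negPf ij).
rewrite !mulr0n mulr0 subrr mul0r sub0r => /eqP.
rewrite mulf_eq0 (gt_eqF (half_norm_gt0 j)) orbF.
by rewrite intr_eq0 oppr_eq0 pnatr_eq0 => /eqP.
Qed.

Variable varpi : 'I_r -> 'rV[int]_r.
Hypothesis varpi_fund : fundamental_weights D alpha varpi.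

Lemma form_weight v i : f v (toQ (varpi i)) = coord v i * half_norm i.
Proof.
rewrite -{1}(simple_coordK alpha_free v) linear_sumlz /= (bigD1 i) //=.
rewrite big1 => [|j ji]; rewrite linearZl_LR /= fC form_simple pairing_toQ;
  rewrite varpi_fund.
  by rewrite eqxx mul1r addr0.
by rewrite eq_sym (negPf ji) mul0r mulr0.
Qed.

Lemma form_weightB v i :
  f v (toQ (varpi i - alpha i)) = coroot_slack v i * half_norm i.
Proof. by rewrite toQB linearBr /= form_weight form_simple -mulrBl. Qed.

Lemma dual_cone_gen v : dual_cone f (cone_C alpha varpi) v <->
  forall i, 0 <= f v (toQ (varpi i)) /\ 0 <= f v (toQ (varpi i - alpha i)).
Proof.
split=> [v_dual i|v_ge0 x].
  by split; apply/v_dual/cone_gen; exists i; [left|right].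
apply: (@cone_functional_ge0 _ unit (fun=> f v) _ _ tt).
  by move=> _ a y z; rewrite linearDr /= linearZr_LR.
by move=> _ [i [|] ->]; have [] := v_ge0 i.
Qed.

Lemma dual_cone_coord v : dual_cone f (cone_C alpha varpi) v <->
  (forall i, 0 <= coord v i) /\ (forall i, 0 <= coroot_slack v i).
Proof.
rewrite dual_cone_gen; split=> [v_ge0|[c_ge0 s_ge0] i].
  by split=> i; have := v_ge0 i;
    rewrite form_weight form_weightB !pmulr_lge0 ?half_norm_gt0 // => -[].
by rewrite form_weight form_weightB !pmulr_lge0 ?half_norm_gt0.
Qed.

Lemma dual_cone_nonsimple v : dual_cone f (cone_C alpha varpi) v <->
  cone (nonsimple_positive D alpha) v.
Proof.
pose L (m : 'I_r + 'I_r) w :=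
  match m with inl i => coord w i | inr i => coroot_slack w i end.
have L_linear m a w u : L m (a *: w + u) = a * L m w + L m u.
  by case: m => i; [apply: simple_coord_linear | apply: coroot_slack_linear].
have L_root b : nonsimple_positive D alpha b -> forall m, 0 <= L m b.
  move=> [c [c_pos c_ns] ->] [] i /=; last exact: nonsimple_slack_ge0.
  by have [n ->] := nat_comb_coord c_pos.2.
rewrite dual_cone_coord; split=> [[c_ge0 s_ge0]|v_cone]; last first.
  split=> i.
    by apply: (cone_functional_ge0 L_linear (m := inl i)) v_cone => b /L_root.
  by apply: (cone_functional_ge0 L_linear (m := inr i)) v_cone => b /L_root.
apply: (cone_of_face_generators L_linear) => [w w_ge0 w_neq0|[]//].
have [|||i [S [S_adm S_supp S_tight]]] := face_star cartan_diag cartan_sym0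
  (x := coord w).
- by move=> i; apply: w_ge0 (inl i).
- by move=> i; rewrite -coroot_slackE; apply: w_ge0 (inr i).
- have [l /eqP wl|w0] := pickP (fun l => coord w l != 0); first by exists l.
  case: w_neq0; rewrite -(simple_coordK alpha_free w) big1 // => l _.
  by have /eqP -> := w0 l; rewrite scale0r.
have S_root := star_nonsimple_positive S_adm.
exists (toQ (star_root i (enum S))); split=> //.
- exact: L_root.
- case=> l /=; rewrite ?coroot_slackE ?coord_star_root; first exact: S_supp.
  move=> /S_tight; rewrite /slack coord_star_root.
  by under [in X in _ -> X]eq_bigr do rewrite coord_star_root.
- exists (inl i); rewrite /= coord_star_root /star eqxx.
  by apply/eqP; rewrite pnatr_eq0.
Qed.
End Form.
End Roots.

Theorem theorem4p2 (r : nat) (D : root_datum r)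
  (D_reduced : reduced D) (D_semisimple : semisimple D)
  (D_simply_connected : simply_connected D)
  (alpha : 'I_r -> 'rV[int]_r) (alpha_base : is_base D alpha)
  (varpi : 'I_r -> 'rV[int]_r) (varpi_fund : fundamental_weights D alpha varpi)
  (f : {dot 'rV[rat]_r for (@idfun rat)}) (f_inv : weyl_invariant D f) :
  forall eta : 'rV[rat]_r,
    (dual_cone f (cone_C alpha varpi) eta <->
       forall i, 0 <= f eta (toQ (varpi i)) /\
                 0 <= f eta (toQ (varpi i - alpha i))) /\
    (dual_cone f (cone_C alpha varpi) eta <->
       cone (nonsimple_positive D alpha) eta).
Proof.
by move=> eta; split; [apply: dual_cone_gen | apply: dual_cone_nonsimple].
Qed.
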